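(* Let $n\ge 2$, let $\lambda_1,\lambda_2,A,B>0$ be real constants, let $p_1,\dots,p_M\in\mathbb{Z}^n$ ($M\ge1$) be distinct points, let $n_1,\dots,n_M>0$ be real constants, and set $h_3=4\pi\sum_{j=1}^M n_j\delta_{p_j}$. If $\lambda_1A-\lambda_2B\ge 0$, then there exists a function $u:\mathbb{Z}^n\to\mathbb{R}$ with $u(x)\ge 0$ for all $x\in\mathbb{Z}^n$ such that $$-\Delta u(x)+\lambda_1e^{Au(x)}\bigl(e^{Au(x)}-1\bigr)+\lambda_2e^{-Bu(x)}\bigl(e^{-Bu(x)}-1\bigr)-h_3(x)=0\qquad\text{for all }x\in\mathbb{Z}^n.$$ If moreover $\lambda_1A-\lambda_2B>0$, this solution has the decay $$u(x)=O\bigl(e^{-m\,d(x)}\bigr),\qquad m=\log\Bigl(1+\frac{\lambda_1A-\lambda_2B}{2n}\Bigr).$$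
   Context: On $\mathbb{Z}^n$ write $d(x,y)=\sum_{i=1}^n|x_i-y_i|$ and $d(x)=d(x,0)$; $x\sim y$ means $d(x,y)=1$. The graph Laplacian of $u:\mathbb{Z}^n\to\mathbb{R}$ is $\Delta u(x)=\sum_{y\sim x}(u(y)-u(x))$. Here $\delta_{p}$ is the function equal to $1$ at $p$ and $0$ elsewhere. The notation $u(x)=O(e^{-md(x)})$ means that there is a constant $C$ with $|u(x)|\le Ce^{-md(x)}$ for all $x\in\mathbb{Z}^n$. *)

(* Defs.v *)
From mathcomp Require Import all_boot all_order all_algebra.
From mathcomp Require Import zify.
From mathcomp Require Import all_classical all_reals all_analysis.

Set Implicit Arguments.
Unset Strict Implicit.
Unset Printing Implicit Defensive.

Import Order.TTheory GRing.Theory Num.Theory.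

Local Open Scope classical_set_scope.
Local Open Scope ring_scope.

Definition dist n (x y : 'rV[int]_n) : nat :=
  (\sum_(i < n) `|(x ord0 i - y ord0 i)%R|)%N.

Definition neighbors n (x : 'rV[int]_n) : set 'rV[int]_n :=
  [set y | dist x y = 1%N].

(* A sum [\sum_(y \in D) F y] over a classical set is 0 by convention when F
   has infinite support on D; this lemma rules that case out in [laplacian]. *)
Lemma finite_neighbors n (x : 'rV[int]_n) : finite_set (neighbors x).
Proof.
pose f (k : 'rV['I_3]_n) : 'rV[int]_n :=
  \row_i (x ord0 i + (k ord0 i : nat)%:Z - 1).
apply: (@sub_finite_set _ _ (f @` [set: 'rV['I_3]_n])); last first.
  exact/finite_image/finite_finset.
move=> y /= dxy.
have le1 i : (`|(x ord0 i - y ord0 i)%R| <= 1)%N.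
  by rewrite -[leqRHS]dxy /dist (bigD1 i) //= leq_addr.
exists (\row_i inord `|(y ord0 i - x ord0 i + 1)%R|%N) => //.
apply/rowP => i; rewrite !mxE; move: (le1 i).
rewrite -[x 0 i]/(x ord0 i) -[y 0 i]/(y ord0 i).
set a := x ord0 i; set b := y ord0 i.
move: a b => a b ab; rewrite inordK; lia.
Qed.

Definition laplacian (R : realType) n (u : 'rV[int]_n -> R)
    (x : 'rV[int]_n) : R :=
  \sum_(y \in neighbors x) (u y - u x).

Definition delta (R : realType) n (p : 'rV[int]_n) : 'rV[int]_n -> R :=
  fun x => (x == p)%:R.

(* u(x) = O(e^{-m d(x)}), with one constant valid on all of Z^n. *)
Definition exp_decay (R : realType) n (u : 'rV[int]_n -> R) (m : R) : Prop :=
  exists C : R, forall x, `|u x| <= C * expR (- m * (dist x 0)%:R).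

(* Main.v *)
Require Import Defs.
From mathcomp Require Import all_boot all_order all_algebra.
From mathcomp Require Import finmap zify ring lra.
From mathcomp Require Import all_classical all_reals all_analysis.
Import Order.TTheory GRing.Theory Num.Theory.
Import numFieldNormedType.Exports.
Local Open Scope ring_scope.

(** Since [f 0 <= 0 <= h] and [f K >= h] for a large constant [K], the constants
    [0] and [K] are a sub- and a supersolution of [laplacian u = f u - h], and
    the pointwise supremum of the subsolutions between them is a solution.
    For [t >= 0] one has [f t >= a t] with [a = lambda1 A - lambda2 B], so away
    from the support of [h] the value of [u] is at most [1 / (1 + a / 2n)] times
    the supremum over the neighbours; iterating this from the outside of a ball
    gives the decay. *)

Lemma laplacianE (R : realType) n (u : 'rV[int]_n -> R) (x : 'rV[int]_n) :
  laplacian u x = \sum_(y <- fset_set (neighbors x)) (u y - u x).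
Proof. by rewrite /laplacian fsbig_finite //; exact: finite_neighbors. Qed.

(** The defect at a point decreases when the values at its neighbours rise. This makes the supremum
    a subsolution, and a strict inequality at one point would leave room to raise the value
    there. *)
Lemma perron_bounded_solution (R : realType) (T : eqType) (N : T -> seq T)
    (f : R -> R) (h : T -> R) (K : R) :
  continuous f -> 0 <= K -> f 0 <= 0 -> (forall x, 0 <= h x) ->
  (forall x, h x <= f K) ->
  exists u : T -> R, (forall x, 0 <= u x <= K) /\
    forall x, \sum_(y <- N x) (u y - u x) = f (u x) - h x.
Proof.
move=> cf K0 f0 h0 hK.
pose S : set (T -> R) := [set v | (forall x, 0 <= v x <= K) /\
  forall x, f (v x) - h x <= \sum_(y <- N x) (v y - v x)]%classic.
pose E x : set R := [set v x | v in S]%classic.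
pose u x : R := sup (E x).
have S0 : S (fun=> 0).
  split=> x; first by rewrite lexx.
  by rewrite big1_seq ?subr_le0 ?(le_trans f0)// => i _; rewrite subrr.
have En x : has_sup (E x).
  split; first by exists 0, (fun=> 0).
  by exists K => _ [v [/(_ x)/andP[_ vK] _] <-].
have Su v x : S v -> v x <= u x.
  by move=> Sv; apply: ub_le_sup; [have [] := En x|exists v].
have uK x : 0 <= u x <= K.
  rewrite (Su _ x S0)/=; apply: ge_sup; first by have [] := En x.
  by move=> _ [v [/(_ x)/andP[_ vK] _] <-].
(* [g x t] is the defect at [x] when the value at [x] is [t] and the
   neighbours keep the values of [u] *)
pose g x (t : R) := f t - h x - \sum_(y <- N x) (u y - t).
have cg x : continuous (g x).
  move=> t; apply: cvgB; first by apply: cvgB; [exact: cf|exact: cvg_cst].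
  apply: cvg_big => [|y _]; first exact: add_continuous.
  by apply: cvgB; [exact: cvg_cst|exact: cvg_id].
(* Otherwise [g x (v x) > 0] for a subsolution [v] with [v x] close to [u x]. Since [v <= u] at the
   neighbours, the defect of [v] at [x] would be at least [g x (v x)], hence positive. *)
have Sg x : g x (u x) <= 0.
  rewrite leNgt; apply/negP => gpos.
  have /(cg x (u x)) : nbhs (g x (u x)) [set s | 0 < s]%classic by exact: lt_nbhsr.
  move=> /nbhs_ballP[e /= e0 He].
  have [_ [v Sv <-] vx] := sup_adherent e0 (En x).
  have /He /= : ball (u x) e (v x).
    by rewrite /ball /= ger0_norm ?subr_ge0 ?Su//; move: vx; rewrite -/(u x); lra.
  rewrite ltNge subr_le0 => /negP; apply.
  by have [_ /(_ x) /le_trans] := Sv; apply; apply: ler_sum => y _; rewrite lerD2r Su.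
exists u; split => // x.
apply/le_anti/andP; split; last by rewrite -subr_le0; exact: Sg.
rewrite leNgt -subr_lt0 -/(g x (u x)); apply/negP => gneg.
(* There must be room below [K]: if [u x = K], the sum over neighbours is nonpositive while
   [f K >= h x], so the defect could not be negative. *)
have uxK : u x < K.
  have /andP[_ ] := uK x; rewrite le_eqVlt => /predU1P[uxE|//].
  move: gneg; rewrite /g uxE => /lt_geF; apply: contraFT => _.
  rewrite subr_ge0 (@le_trans _ _ 0) ?subr_ge0//.
  by apply: sumr_le0 => y _; rewrite subr_le0; have /andP[] := uK y.
have /(cg x (u x)) : nbhs (g x (u x)) [set s | s < 0]%classic by exact: lt_nbhsl.
move=> /nbhs_ballP[e /= e0 He].
pose t := Num.min K (u x + e / 2).
have ut : u x < t by rewrite lt_min uxK ltrDl divr_gt0.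
have tK : t <= K by rewrite ge_min lexx.
have tu : t <= u x + e / 2 by rewrite ge_min lexx orbT.
have /He /= : ball (u x) e t.
  by rewrite /ball /= distrC ger0_norm ?subr_ge0 ?(ltW ut)//; lra.
move=> gt0.
(* Raising [u] at [x] alone keeps a subsolution: at [x] because [g x t < 0], elsewhere because the
   sums can only grow. Its value [t > u x] then contradicts the supremum. *)
pose v y := if y == x then t else u y.
have uv y : u y <= v y by rewrite /v; case: eqP => [->|_]; rewrite ?(ltW ut).
have /(Su v x) : S v.
  split=> y.
    rewrite /v; case: eqP => // _; rewrite tK andbT.
    by rewrite (le_trans _ (ltW ut))//; have /andP[] := uK x.
  have [->|yx] := eqVneq y x.
    rewrite {1 3}/v eqxx -subr_le0 (le_trans _ (ltW gt0))// lerB//.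
    by apply: ler_sum => z _; rewrite lerD2r.
  rewrite {1 3}/v (negbTE yx); have := Sg y; rewrite subr_le0 => /le_trans; apply.
  by apply: ler_sum => z _; rewrite lerD2r.
by rewrite /v eqxx leNgt ut.
Qed.

Lemma dist_neighbor n (x y : 'rV[int]_n) :
  neighbors x y -> (dist x 0 <= (dist y 0).+1)%N.
Proof.
rewrite /neighbors /= => xy.
suff : (dist x 0 <= dist y 0 + dist x y)%N by rewrite xy addn1.
rewrite /dist -big_split /=.
by apply: leq_sum => i _; rewrite !mxE !subr0; lia.
Qed.

(** Integer distance 1 forces exactly one coordinate to differ, by 1, so each neighbour occurs in
    the list of the points [x] plus or minus a basis vector. *)
Lemma size_neighbors n (x : 'rV[int]_n) :
  (size (fset_set (neighbors x)) <= 2 * n)%N.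
Proof.
pose s := [seq x + (-1) ^+ (q.2 : bool) *: delta_mx 0 q.1 | q : 'I_n * bool].
have -> : (2 * n)%N = size s.
  by rewrite size_map -cardE card_prod card_ord card_bool mulnC.
apply: uniq_leq_size => [|y]; first exact: fset_uniq.
rewrite in_fset_set; last exact: finite_neighbors.
rewrite inE /neighbors /dist /= => /eqP /sum_nat_eq1[i [_ i1 i0]].
apply/mapP; exists (i, y ord0 i < x ord0 i); first by rewrite mem_enum.
apply/rowP => j; rewrite !mxE /= -[x 0 j]/(x ord0 j) -[y 0 j]/(y ord0 j).
have [->|ji] := eqVneq j i; first by rewrite mulr1; case: ltP i1 => /=; lia.
by have := i0 j ji isT; rewrite ?(negbTE ji) /= mulr0 addr0; lia.
Qed.

Lemma geometric_decay (R : realType) n (u : 'rV[int]_n -> R) (a K : R) (L : nat) :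
  (0 < n)%N -> 0 < a -> (forall x, 0 <= u x <= K) ->
  (forall x, (L < dist x 0%R)%N -> a * u x <= laplacian u x) ->
  forall k x, (L + k <= dist x 0%R)%N -> u x <= K * (1 + a / (2 * n%:R)) ^- k.
Proof.
move=> n0 a0 uK lap; have u0 x : 0 <= u x by have /andP[] := uK x.
have n20 : 0 < 2 * n%:R :> R by rewrite mulr_gt0// ltr0n.
set q := 1 + a / (2 * n%:R).
have q0 : 0 < q by rewrite ltr_wpDr// divr_ge0 ?ltW.
have qE : 2 * n%:R * q = 2 * n%:R + a.
  by rewrite mulrDr mulr1 mulrCA mulfV ?mulr1// gt_eqF.
elim=> [x _|k IH x Lk]; first by rewrite expr0 invr1 mulr1; have /andP[] := uK x.
set c := K * q ^- k in IH *.
have K0 : 0 <= K by apply: le_trans (u0 x) _; have /andP[] := uK x.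
have c0 : 0 <= c by rewrite mulr_ge0// invr_ge0 exprn_ge0// ltW.
have -> : K * q ^- k.+1 = c / q by rewrite /c exprSr invfM mulrA.
rewrite ler_pdivlMr//; set N := fset_set (neighbors x).
have Lx : (L < dist x 0%R)%N by rewrite (leq_trans _ Lk)// addnS ltnS leq_addr.
have lapN : a * u x <= (size N)%:R * (c - u x).
  apply: le_trans (lap x Lx) _; rewrite laplacianE.
  apply: (@le_trans _ _ (\sum_(y <- N) (c - u x))).
    rewrite big_seq [leRHS]big_seq; apply: ler_sum => y.
    rewrite in_fset_set ?inE; last exact: finite_neighbors.
    by move=> /dist_neighbor yx; rewrite lerD2r IH// -ltnS -addnS (leq_trans Lk).
  by rewrite big_const_seq count_predT iter_addr_0 mulr_natl.
(* The sign of [c - u x] is needed before the number of neighbours can be replaced by its upper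
   bound [2 * n]. *)
have uc : u x <= c.
  rewrite leNgt; apply/negP => cu.
  have : 0 < a * u x by rewrite mulr_gt0// (le_lt_trans c0).
  by rewrite ltNge (le_trans lapN)// mulr_ge0_le0 ?ler0n// subr_le0 ltW.
have lap2n : a * u x <= 2 * n%:R * (c - u x).
  have := size_neighbors n x; rewrite -(ler_nat R) natrM => Nn.
  by rewrite (le_trans lapN)// ler_wpM2r ?subr_ge0.
rewrite -(ler_pM2l n20) mulrCA qE; lra.
Qed.

Theorem theorem1p1 (R : realType) (n : nat) (hn : (2 <= n)%N)
    (lambda1 lambda2 A B : R)
    (hlambda1 : 0 < lambda1) (hlambda2 : 0 < lambda2) (hA : 0 < A) (hB : 0 < B)
    (M : nat) (hM : (1 <= M)%N)
    (p : 'I_M -> 'rV[int]_n) (hp : injective p)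
    (nu : 'I_M -> R) (hnu : forall j, 0 < nu j) :
  let h3 := fun x : 'rV[int]_n => 4 * pi * \sum_(j < M) nu j * delta R (p j) x in
  0 <= lambda1 * A - lambda2 * B ->
  exists u : 'rV[int]_n -> R,
    [/\ forall x, 0 <= u x,
        forall x,
          - laplacian u x
          + lambda1 * expR (A * u x) * (expR (A * u x) - 1)
          + lambda2 * expR (- B * u x) * (expR (- B * u x) - 1)
          - h3 x = 0
      & 0 < lambda1 * A - lambda2 * B ->
        exp_decay u (ln (1 + (lambda1 * A - lambda2 * B) / (2 * n%:R)))].
Proof.
move=> h3 _.
pose f (t : R) : R := lambda1 * expR (A * t) * (expR (A * t) - 1)
  + lambda2 * expR (- B * t) * (expR (- B * t) - 1).
set a := lambda1 * A - lambda2 * B.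
have pi4 : 0 <= 4 * pi :> R by rewrite mulr_ge0 ?pi_ge0.
have h30 x : 0 <= h3 x.
  by rewrite mulr_ge0// sumr_ge0// => j _; rewrite mulr_ge0 ?ler0n// ltW.
pose H : R := 4 * pi * \sum_(j < M) nu j.
have h3H x : h3 x <= H.
  rewrite ler_wpM2l// ler_sum// => j _.
  by rewrite ler_piMr ?(ltW (hnu j))// /delta; case: eqP.
have expM1 (t : R) : 0 <= t -> t <= expR t * (expR t - 1).
  move=> t0; have := expR_ge1Dx t; have : 1 <= expR t by rewrite -expR0 ler_expR.
  nra.
have f1 (t : R) : 0 <= t ->
    lambda1 * A * t <= lambda1 * expR (A * t) * (expR (A * t) - 1).
  by move=> t0; rewrite -!mulrA ler_pM2l// expM1// mulr_ge0// ltW.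
(* With [s = expR (- B * t)], [s (s - 1) >= s - 1 >= - B t], the first step because
   [(s - 1)^2 >= 0]. *)
have f2 (t : R) : 0 <= t ->
    - (lambda2 * B * t) <= lambda2 * expR (- B * t) * (expR (- B * t) - 1).
  move=> t0; rewrite -!mulrA -mulrN ler_pM2l// -mulNr.
  have := expR_ge1Dx (- B * t); have := expR_gt0 (- B * t).
  have : expR (- B * t) <= 1 by rewrite -expR0 ler_expR mulNr oppr_le0 mulr_ge0// ltW.
  nra.
have fa t : 0 <= t -> a * t <= f t.
  by move=> t0; have := f1 t t0; have := f2 t t0; rewrite /f /a; lra.
have cexp (c : R) : continuous (fun t : R => expR (c * t)).
  move=> t; apply: continuous_comp; last exact: continuous_expR.
  exact: mulrl_continuous.
have cf : continuous f.
  move=> t; apply: cvgD; apply: cvgM.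
  - by apply: cvgM; [exact: cvg_cst|exact: cexp].
  - by apply: cvgB; [exact: cexp|exact: cvg_cst].
  - by apply: cvgM; [exact: cvg_cst|exact: cexp].
  - by apply: cvgB; [exact: cexp|exact: cvg_cst].
have lA : 0 < lambda1 * A by rewrite mulr_gt0.
have H0 : 0 <= H := le_trans (h30 0) (h3H 0).
(* By [f1] the first term of [f K] is at least [H + lambda2]; the extra [lambda2] absorbs the second
   term, which is at least [- lambda2]. *)
pose K := (H + lambda2) / (lambda1 * A).
have K0 : 0 <= K by rewrite divr_ge0 ?addr_ge0// ltW.
have KE : lambda1 * A * K = H + lambda2 by rewrite mulrC divfK// gt_eqF.
have HfK : H <= f K.
  have := f1 K K0; rewrite KE /f; set s := expR (- B * K).
  have : 0 <= lambda2 * ((s - 1) ^+ 2 + s).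
    by rewrite mulr_ge0 ?addr_ge0 ?sqr_ge0 ?expR_ge0// ltW.
  nra.
have f00 : f 0 <= 0 by rewrite /f !mulr0 expR0 subrr !mulr0 addr0.
have [u [uK ueq]] := @perron_bounded_solution R _
  (fun x => fset_set (neighbors x)) f h3 K cf K0 f00 h30 (fun x => le_trans (h3H x) HfK).
have u0 x : 0 <= u x by have /andP[] := uK x.
exists u; split => // [x|apos].
  by rewrite laplacianE ueq /f; ring.
(* A sum dominates each of its terms, so the ball of radius [L] contains every [p j]. *)
pose L := (\sum_(j < M) (dist (p j) 0%R))%N.
have hL x : (L < dist x 0)%N -> h3 x = 0.
  move=> Lx; rewrite /h3 big1 ?mulr0// => j _; rewrite /delta.
  case: eqP => [xE|]; rewrite ?mulr0//.
  by move: Lx; rewrite xE ltnNge /L (bigD1 j)//= leq_addr.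
have n0 : (0 < n)%N by exact: leq_trans hn.
have decay : forall k x, (L + k <= dist x 0%R)%N ->
    u x <= K * (1 + a / (2 * n%:R)) ^- k.
  apply: geometric_decay => // x Lx.
  by rewrite laplacianE ueq hL// subr0 fa.
have an0 : 0 <= a / (2 * n%:R) by rewrite divr_ge0 ?mulr_ge0 ?ler0n ?ltW.
set q := 1 + a / (2 * n%:R) in decay *.
have q0 : 0 < q by rewrite ltr_wpDr.
have q1 : 1 <= q by rewrite lerDl.
(* Outside the ball [decay] applies with [k = dist x 0 - L]; inside it [u x <= K] suffices, since
   [q ^+ (L - dist x 0) >= 1]. *)
exists (K * q ^+ L) => x.
rewrite ger0_norm// mulNr expRN expRM_natr lnK ?posrE//.
have [Lx|xL] := leqP L (dist x 0).
  rewrite -(subnKC Lx) exprD invfM mulrA mulfK ?expf_neq0 ?gt_eqF//.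
  by rewrite decay// subnKC.
rewrite -(subnKC (ltnW xL)) exprD mulrA mulrAC mulfK ?expf_neq0 ?gt_eqF//.
by rewrite (@le_trans _ _ K)//; [have /andP[] := uK x|rewrite ler_peMr// exprn_ege1].
Qed.
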